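(* Suppose $p=p(n)\in[0,1]$ satisfies $p(n)\le\frac{1}{\sqrt{n}\,\log n}$. Then asymptotically almost surely $\Gamma\in\mathcal{G}(n,p)$ is not in $\mathcal{CFS}$.
   Context: Graphs are finite and simple. $\mathcal{G}(n,p)$ is the random graph on $n$ labelled vertices in which each of the $\binom n2$ possible edges is included independently with probability $p=p(n)$. A property holds asymptotically almost surely if its probability tends to $1$ as $n\to\infty$. ''Subgraph'' means induced subgraph. A clique is a complete graph on $t\ge 0$ vertices (the empty graph is a clique). The join $A\star B$ is obtained from $A\sqcup B$ by joining every vertex of $A$ to every vertex of $B$. The square-graph $\square(\Gamma)$ of a graph $\Gamma$ is the graph whose vertices are the induced $4$-cycles of $\Gamma$, with two distinct $4$-cycles joined by an edge if and only if they share a diagonal, i.e. their vertex sets have in common a pair of vertices that are non-adjacent in $\Gamma$ (they may have a third vertex in common). A graph $\Gamma$ belongs to $\mathcal{CFS}$ if $\Gamma=\Gamma'\star K$, where $K$ is a (possibly empty) clique and $\Gamma'$ is a non-empty subgraph such that $\square(\Gamma')$ has a connected component $C$ for which the union of the $4$-cycles in $C$ covers all of $V(\Gamma')$. *)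

(* Defs.v *)
From HB Require Import structures.
From mathcomp Require Import all_boot all_order all_algebra.
From mathcomp Require Import all_classical all_reals all_analysis.

Set Implicit Arguments.
Unset Strict Implicit.
Unset Printing Implicit Defensive.

Import Order.TTheory GRing.Theory Num.Theory.
Import numFieldNormedType.Exports.

Local Open Scope classical_set_scope.
Local Open Scope ring_scope.

Record sgraph (T : finType) := SGraph {
  edges : {set {set T}};
  edgesP : [forall e in edges, #|e| == 2%N] }.

HB.instance Definition _ (T : finType) := [isSub for @edges T].
HB.instance Definition _ (T : finType) := [Finite of sgraph T by <:].

Section Graphs.
Variable T : finType.
Implicit Types (G : sgraph T) (x y : T) (A B : {set T}).

(* Irreflexive, since [set x; x] has only one element. *)
Definition adj G : rel T := fun x y => [set x; y]%SET \in edges G.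

Definition rel_edges (r : rel T) : {set {set T}} :=
  [set e | [exists x, exists y, [&& x != y, r x y & e == [set x; y]]]]%SET.

Lemma rel_edgesP (r : rel T) : [forall e in rel_edges r, #|e| == 2%N].
Proof.
apply/forall_inP => e; rewrite inE => /existsP[x /existsP[y]].
by case/and3P => xy _ /eqP ->; rewrite cards2 xy.
Qed.

(* The simple graph of r, symmetrised and without loops. *)
Definition graph_of_rel (r : rel T) : sgraph T := SGraph (rel_edgesP r).

Lemma adjC G x y : adj G x y = adj G y x.
Proof. by rewrite /adj finset.setUC. Qed.

Lemma adjxx G x : adj G x x = false.
Proof.
apply/negbTE/negP => xx; have /forall_inP/(_ _ xx) := edgesP G.
by rewrite cards2 eqxx.
Qed.

Lemma adj_graph_of_rel (r : rel T) x y :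
  adj (graph_of_rel r) x y = (x != y) && (r x y || r y x).
Proof.
rewrite /adj inE; apply/existsP/andP => [[a /existsP[b]]|[xy]].
  case/and3P => ab rab /eqP xyab.
  have xy : x != y.
    by have := cards2 x y; rewrite xyab cards2 ab; case: (x != y).
  split=> //.
  have : x \in [set a; b]%SET by rewrite -xyab !inE eqxx.
  have : y \in [set a; b]%SET by rewrite -xyab !inE eqxx orbT.
  rewrite !inE => /orP[]/eqP ya /orP[]/eqP xa; move: xy; subst x y;
  by rewrite ?eqxx // rab ?orbT.
case/orP => rxy; first by exists x; apply/existsP; exists y; rewrite xy rxy /=.
by exists y; apply/existsP; exists x; rewrite eq_sym xy rxy finset.setUC /=.
Qed.

Definition is_clique G B : bool :=
  [forall x in B, forall y in B, (x != y) ==> adj G x y].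

Definition is_component G A : bool :=
  [exists x, A == [set y | connect (adj G) x y]%SET].

(* An induced 4-cycle is determined by its vertex set S. *)
Definition induced_C4 G (S : {set T}) : bool :=
  [exists a, exists b, exists c, exists d,
    [&& uniq [:: a; b; c; d], S == [set a; b; c; d]%SET,
        adj G a b, adj G b c, adj G c d, adj G d a,
        ~~ adj G a c & ~~ adj G b d]].

Definition C4 G : finType := {S : {set T} | induced_C4 G S}.

Definition share_diagonal G : rel (C4 G) := fun S1 S2 =>
  [exists x, exists y, [&& x != y, ~~ adj G x y,
    [set x; y]%SET \subset val S1 & [set x; y]%SET \subset val S2]].

End Graphs.

Definition square_graph (T : finType) (G : sgraph T) : sgraph (C4 G) :=
  graph_of_rel (@share_diagonal T G).

Definition induced_subgraph (T : finType) (G : sgraph T) (A : {set T}) :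
    sgraph {x : T | x \in A} :=
  graph_of_rel (fun u v => adj G (val u) (val v)).

(* G is the join of its induced subgraphs on A and on B. *)
Definition is_join (T : finType) (G : sgraph T) (A B : {set T}) : bool :=
  [&& A :|: B == [set: T], [disjoint A & B] &
      [forall x in A, forall y in B, adj G x y]]%SET.

Definition square_covered (T : finType) (G : sgraph T) : bool :=
  [exists C : {set C4 G}, is_component (square_graph G) C &&
    (\bigcup_(S in C) val S == [set: T])%SET].

Definition CFS (T : finType) (G : sgraph T) : bool :=
  [exists A : {set T}, exists B : {set T},
    [&& A != finset.set0, is_join G A B, is_clique G B &
        square_covered (induced_subgraph G A)]].

(* The probability that a random graph in G(n, p) satisfies P; the weight of a
   graph is the product over the potential edges given by independence. *)
Definition gnp_prob (R : realType) (n : nat) (p : R) (P : pred (sgraph 'I_n)) : R :=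
  \sum_(G : sgraph 'I_n | P G)
    \prod_(e : {set 'I_n} | #|e| == 2%N) (if e \in edges G then p else 1 - p).

Lemma gnp_prob_total (R : realType) (n : nat) (p : R) :
  gnp_prob p (@predT (sgraph 'I_n)) = 1.
Proof.
pose c (e : {set 'I_n}) := #|e| == 2%N.
transitivity (\prod_e ((if c e then p else 0) + (if c e then 1 - p else 1)));
  last first.
  by apply: big1 => e _; case: ifP; rewrite ?add0r // addrC subrK.
rewrite bigA_distr /gnp_prob (bigID (fun J : {set {set 'I_n}} => [forall e in J, c e])) /=.
rewrite [X in _ = _ + X]big1 ?addr0 => [|J /forall_inPn[e eJ /negbTE ce]]; last first.
  by rewrite (bigD1 e) //= eJ ce mul0r.
rewrite [RHS](reindex_omap (@edges _) insub) /=; last first.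
  by move=> J cJ; rewrite insubT.
apply: eq_big => [G|G _].
  by rewrite edgesP (valK G) eqxx.
rewrite big_mkcond; apply: eq_bigr => e _.
rewrite -/(c e); case: ifPn => // ce; case: ifPn => // eG.
by have /forall_inP/(_ _ eG) := edgesP G; rewrite -/(c e) (negbTE ce).
Qed.

Definition aas (R : realType) (p : nat -> R)
    (P : forall n, pred (sgraph 'I_n)) : Prop :=
  (fun n => gnp_prob (p n) (P n)) @ \oo --> (1%R : R).

(* Main.v *)
(** In a graph of CFS, start from a diagonal {x, y} of a 4-cycle of the covering
    component and keep adding vertices with at least two neighbours in the set
    reached so far. This never stops before all vertices are reached: a 4-cycle
    with a diagonal in the set must lie in the set, hence so does the whole
    component, and the vertices of the clique factor are adjacent to x and y.
    So for every k between 2 and n there are k vertices spanning at least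
    2k - 4 edges. The expected number of such (set, edges) pairs is at most
    C(n, k) C(C(k, 2), 2k - 4) p^(2k - 4); with k about log n and
    n p^2 <= 1 / log^2 n it is n^2 (O(1) / log n)^(k - 2), which is O(1 / n). *)

Require Import Defs.
From mathcomp Require Import all_boot all_order all_algebra.
From mathcomp Require Import all_classical all_reals all_analysis.
From mathcomp Require Import zify ring lra.

Import Order.TTheory GRing.Theory Num.Theory.
Import numFieldNormedType.Exports.

Local Open Scope ring_scope.

(** * Two-neighbour percolation from a diagonal of a 4-cycle *)

Lemma induced_C4_nonadj {T : finType} {G : sgraph T} {S : {set T}} :
  induced_C4 G S ->
  exists x y, [/\ x \in S, y \in S, x != y & ~~ adj G x y].
Proof.
case/existsP=> a /existsP[b /existsP[c /existsP[d /and5P[U /eqP -> _ _]]]].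
case/and4P=> _ _ ac _; exists a, c; rewrite !inE !eqxx !orbT; split=> //.
by move: U; rewrite /= !inE !negb_or => /andP[/and3P[]].
Qed.

(** The only non-adjacent pairs of a 4-cycle are its two diagonals, and the ends of one diagonal are
    the neighbours of both ends of the other. *)
Lemma induced_C4_common_neighbour {T : finType} {G : sgraph T} {S : {set T}}
    {x y w : T} :
  induced_C4 G S -> x \in S -> y \in S -> x != y -> ~~ adj G x y ->
  w \in S -> w != x -> w != y -> adj G w x /\ adj G w y.
Proof.
case/existsP=> a /existsP[b /existsP[c /existsP[d /and5P[_ /eqP -> ab bc]]]].
case/and4P=> cd da _ _.
have [ba cb dc ad] : [/\ adj G b a, adj G c b, adj G d c & adj G a d].
  by rewrite ![adj _ b a]adjC ![adj _ c b]adjC ![adj _ d c]adjC [adj _ a d]adjC.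
rewrite !inE -!orbA => /or4P[]/eqP-> /or4P[]/eqP-> xy nxy /or4P[]/eqP-> wx wy;
  split=> //; move: xy nxy wx wy;
  by rewrite ?eqxx ?ab ?bc ?cd ?da ?ba ?cb ?dc ?ad.
Qed.

(** These are the sets at which 2-neighbour bootstrap percolation stops. *)
Definition two_closed {T : finType} (G : sgraph T) (S : {set T}) : Prop :=
  forall w x y : T, x \in S -> y \in S -> x != y ->
    adj G w x -> adj G w y -> w \in S.

(** Percolation from [x] and [y] reaches everything; quantifying over closed supersets avoids
    running the process. *)
Definition two_closure_full {T : finType} (G : sgraph T) (x y : T) : Prop :=
  forall S : {set T}, x \in S -> y \in S -> two_closed G S ->
    forall w : T, w \in S.

(** Inclusion in a closed set passes along edges of the square graph, so it is constant on
    components. *)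
Lemma square_covered_two_closure_full {T : finType} {G : sgraph T} :
  square_covered G -> exists x y : T, x != y /\ two_closure_full G x y.
Proof.
case/existsP=> C /andP[/existsP[Q /eqP -> cov]].
have [x [y [xQ yQ xy nxy]]] := induced_C4_nonadj (valP Q).
exists x, y; split=> // S xS yS closedS.
have subS (Q' : C4 G) u v : u != v -> ~~ adj G u v -> u \in val Q' ->
    v \in val Q' -> u \in S -> v \in S -> val Q' \subset S.
  move=> uv nuv uQ vQ uS vS; apply/fintype.subsetP=> w wQ.
  have [->//|wu] := eqVneq w u; have [->//|wv] := eqVneq w v.
  have [awu awv] :=
    induced_C4_common_neighbour (valP Q') uQ vQ uv nuv wQ wu wv.
  exact: closedS uv awu awv.
pose inS : {pred C4 G} := [pred Q' : C4 G | val Q' \subset S].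
have step Q1 Q2 : share_diagonal Q1 Q2 || share_diagonal Q2 Q1 ->
    Q1 \in inS -> Q2 \in inS.
  rewrite !inE => sh Q1S.
  have {sh}[u [v [uv nuv]]] : exists u v, [/\ u != v, ~~ adj G u v,
      [set u; v]%SET \subset val Q1 & [set u; v]%SET \subset val Q2].
    by case/orP: sh => /existsP[u /existsP[v /and4P[]]] *; exists u, v.
  rewrite !finset.subUset !finset.sub1set => /andP[u1 v1] /andP[u2 v2].
  by apply: (subS _ u v); rewrite // (fintype.subsetP Q1S).
have symQ : connect_sym (adj (square_graph G)).
  by apply: sym_connect_sym => Q1 Q2; rewrite adjC.
have clQ : fingraph.closed (adj (square_graph G)) inS.
  apply: intro_closed => // Q1 Q2; rewrite adj_graph_of_rel => /andP[_].
  exact: step.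
move=> w; have : w \in [set: T]%SET by rewrite inE.
rewrite -(eqP cov) => /finset.bigcupP[Q']; rewrite inE => QQ' wQ'.
have := closed_connect clQ QQ'; rewrite !inE (subS Q x y) // => /esym Q'S.
exact: (fintype.subsetP Q'S).
Qed.

Lemma CFS_two_closure_full {T : finType} {G : sgraph T} :
  CFS G -> exists x y : T, x != y /\ two_closure_full G x y.
Proof.
case/existsP=> A /existsP[B /and4P[_ /and3P[/eqP AB _ /forall_inP joinAB] _]].
case/square_covered_two_closure_full=> u [v [uv full]].
exists (val u), (val v); split=> [|S uS vS closedS w].
  by rewrite (inj_eq val_inj).
(* The trace on [A] of a closed set is closed in the induced subgraph, so fullness there gives all
   of [A]. *)
have AS z : z \in A -> z \in S.
  move=> zA; have -> : z = val (exist (fun i => i \in A) z zA) by [].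
  have := full [set i | val i \in S]%SET; rewrite 2!inE => /(_ uS vS) H.
  have/H/(_ (exist _ z zA)) : two_closed (induced_subgraph G A)
      [set i | val i \in S]%SET; last by rewrite inE.
  move=> i j k; rewrite !inE !adj_graph_of_rel => jS kS jk.
  rewrite ![adj G (val j) _]adjC ![adj G (val k) _]adjC !orbb.
  move=> /andP[_ ij] /andP[_ ik].
  by apply: closedS ij ik; rewrite // (inj_eq val_inj).
have : w \in [set: T]%SET by rewrite inE.
rewrite -AB inE => /orP[/AS//|wB].
have join (i : {x : T | x \in A}) : adj G w (val i).
  by have /forall_inP/(_ w wB) := joinAB _ (valP i); rewrite adjC.
by apply: closedS (join u) (join v); rewrite // (inj_eq val_inj).
Qed.

(** Starting from two vertices, each of [j] added vertices brings two new edges into the set reached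
    so far. *)
Lemma two_closure_full_dense {T : finType} {G : sgraph T} {x y : T} (j : nat) :
  x != y -> two_closure_full G x y -> (j.+2 <= #|T|)%N ->
  exists S : {set T}, #|S| = j.+2 /\
    (j.*2 <= #|[set e in edges G | e \subset S]%SET|)%N.
Proof.
move=> xy full jT.
suff [S [xS yS cS eS]] : exists S : {set T}, [/\ x \in S, y \in S, #|S| = j.+2 &
    (j.*2 <= #|[set e in edges G | e \subset S]%SET|)%N] by exists S.
elim: j jT => [|j IHj] jT.
  by exists [set x; y]%SET; rewrite !inE !eqxx orbT cards2 xy.
have [S [xS yS cS eS]] := IHj (ltnW jT).
(* If no vertex could be added, [S] would be closed, hence everything, against its cardinality. *)
have [w [a [b [aS bS ab /and3P[wa wb wS]]]]] : exists w a b : T,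
    [/\ a \in S, b \in S, a != b & [&& adj G w a, adj G w b & w \notin S]].
  apply: contrapT => none.
  suff SE : S = [set: T]%SET by move: jT; rewrite -cardsT -SE cS ltnn.
  apply/finset.setP=> z; rewrite [RHS]inE; apply: full => // w a b aS bS ab wa wb.
  by apply/negPn/negP=> wS; apply: none; exists w, a, b; rewrite wa wb wS.
exists (w |: S)%SET; rewrite !inE xS yS !orbT cardsU1 wS cS; split=> //.
set E := [set e in edges G | e \subset S]%SET in eS *.
have out z : [set w; z]%SET \notin E.
  by rewrite inE finset.subUset finset.sub1set (negPf wS) andbF.
have neq : [set w; a]%SET != [set w; b]%SET.
  apply/eqP=> /finset.setP/(_ a); rewrite !inE eqxx (negPf ab) orbT orbF => /esym/eqP wa'.
  by rewrite -wa' aS in wS.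
apply: (@leq_trans #|[set w; a] |: ([set w; b] |: E)|%SET).
  by rewrite !cardsU1 finset.in_setU1 (negPf neq) !out doubleS !add1n !ltnS.
apply/subset_leq_card/fintype.subsetP=> e; rewrite /E !inE => /or3P[/eqP->|/eqP->|].
- by rewrite [_ \in edges G]wa finset.subUset !finset.sub1set !inE eqxx aS orbT.
- by rewrite [_ \in edges G]wb finset.subUset !finset.sub1set !inE eqxx bS orbT.
- by case/andP=> -> eS1; apply: fintype.subset_trans eS1 _; exact: finset.subsetUr.
Qed.

(** * Probabilities and first moments in G(n, p) *)

Lemma sum_sgraph_prod {R : comNzRingType} {T : finType} (w1 w0 : {set T} -> R) :
  \sum_(G : sgraph T)
    \prod_(e : {set T} | #|e| == 2%N) (if e \in edges G then w1 e else w0 e) =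
  \prod_(e : {set T} | #|e| == 2%N) (w1 e + w0 e).
Proof.
pose c (e : {set T}) := #|e| == 2%N.
(* Padding with 0 and 1 at the non-pairs gives a product over all vertex sets, whose expansion keeps
   only the edge sets of graphs. *)
transitivity (\prod_e ((if c e then w1 e else 0) + (if c e then w0 e else 1)));
  last first.
  rewrite [RHS]big_mkcond; apply: eq_bigr => e _.
  by rewrite -/(c e); case: (c e); rewrite ?add0r.
rewrite bigA_distr [RHS](bigID (fun J : {set {set T}} => [forall e in J, c e])) /=.
rewrite [X in _ = _ + X]big1 ?addr0 => [|J /forall_inPn[e eJ /negbTE ce]]; last first.
  by rewrite (bigD1 e) //= eJ ce mul0r.
rewrite [RHS](reindex_omap (@edges T) insub) /=; last first.
  by move=> J cJ; rewrite insubT.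
apply: eq_big => [G|G _]; first by rewrite edgesP (valK G) eqxx.
rewrite big_mkcond; apply: eq_bigr => e _.
rewrite -/(c e); case: ifPn => // ce; case: ifPn => // eG.
by have /forall_inP/(_ _ eG) := edgesP G; rewrite -/(c e) (negbTE ce).
Qed.

Lemma gnp_weight_ge0 {R : realType} {n : nat} {p : R} (G : sgraph 'I_n) :
  0 <= p <= 1 ->
  0 <= \prod_(e : {set 'I_n} | #|e| == 2%N)
         (if e \in edges G then p else 1 - p).
Proof.
by case/andP=> p0 p1; apply: prodr_ge0 => e _; case: ifP => _ //; rewrite subr_ge0.
Qed.

Lemma gnp_prob_subset_edges {R : realType} {n : nat} (p : R)
    (F : {set {set 'I_n}}) :
  {in F, forall e : {set 'I_n}, #|e| = 2%N} ->
  gnp_prob p (fun G => F \subset edges G) = p ^+ #|F|.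
Proof.
(* Absence of an edge of [F] gets weight 0, so the sum over all graphs keeps only those containing
   [F]. *)
move=> F2; pose w0 e := if e \in F then 0 else 1 - p.
transitivity (\prod_(e : {set 'I_n} | #|e| == 2%N) (p + w0 e)).
  rewrite -(sum_sgraph_prod (fun=> p)) [RHS](bigID (fun G => F \subset edges G)) /=.
  rewrite [X in _ + X]big1 ?addr0 => [|G /subsetPn[e eF /negPf eG]]; last first.
    by rewrite (bigD1 e) ?F2 //= eG /w0 eF mul0r.
  apply: eq_bigr => G FG; apply: eq_bigr => e _; case: ifPn => // eG.
  have /negPf eF : e \notin F by apply: contra eG; exact: (fintype.subsetP FG).
  by rewrite /w0 eF.
rewrite (bigID (mem F)) /= [X in _ * X]big1 ?mulr1 => [|e /andP[_ /negPf eF]].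
  rewrite -prodr_const; apply: eq_big => [e|e /andP[_ eF]].
    by rewrite /= andb_idl // => /F2 ->.
  by rewrite /w0 eF addr0.
by rewrite /w0 eF addrC subrK.
Qed.

Lemma gnp_prob_union_bound {R : realType} {n : nat} {p : R} {I : finType}
    (Q : pred I) (P : pred (sgraph 'I_n)) (A : I -> pred (sgraph 'I_n)) :
  0 <= p <= 1 -> (forall G, P G -> exists2 i, Q i & A i G) ->
  gnp_prob p P <= \sum_(i | Q i) gnp_prob p (A i).
Proof.
move=> p01 PA; rewrite /gnp_prob; under [leRHS]eq_bigr do rewrite big_mkcond.
rewrite exchange_big /= big_mkcond; apply: ler_sum => G _.
have w0 := gnp_weight_ge0 G p01.
case: ifP => [/PA[i Qi AiG]|_]; last by apply: sumr_ge0 => i _; case: ifP.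
rewrite (bigD1 i) //= AiG lerDl; apply: sumr_ge0 => k _; by case: ifP.
Qed.

Lemma gnp_prob_predC {R : realType} {n : nat} (p : R) (P : pred (sgraph 'I_n)) :
  gnp_prob p (fun G => ~~ P G) = 1 - gnp_prob p P.
Proof.
by rewrite -(gnp_prob_total n p) /gnp_prob [in RHS](bigID P) /= addrAC subrr add0r.
Qed.

Lemma gnp_prob_CFS_le {R : realType} {n : nat} {p : R} (j : nat) :
  0 <= p <= 1 -> (j.+2 <= n)%N ->
  gnp_prob p (@CFS 'I_n) <= ('C(n, j.+2) * 'C('C(j.+2, 2), j.*2))%:R * p ^+ j.*2.
Proof.
move=> p01 jn.
pose pairs (S : {set 'I_n}) := [set e : {set 'I_n} | e \subset S & #|e| == 2%N]%SET.
pose Q (SF : {set 'I_n} * {set {set 'I_n}}) :=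
  (#|SF.1| == j.+2) && ((SF.2 \subset pairs SF.1) && (#|SF.2| == j.*2)).
have dense G : CFS G -> exists2 SF, Q SF & SF.2 \subset edges G.
  case/CFS_two_closure_full=> x [y [xy full]].
  have [|S [cS eS]] := two_closure_full_dense j xy full; first by rewrite card_ord.
  (* Among at least 2j edges inside [S], exactly 2j can be chosen, since the binomial counting the
     choices is positive. *)
  have : (0 < #|[set F : {set {set 'I_n}} |
      F \subset [set e in edges G | e \subset S] & #|F| == j.*2]%SET|)%N.
    by rewrite cards_draws bin_gt0.
  case/card_gt0P=> F; rewrite inE => /andP[/fintype.subsetP FE cF].
  exists (S, F); last by apply/fintype.subsetP=> e /FE; rewrite inE => /andP[].
  rewrite /Q /= cS cF eqxx andbT; apply/fintype.subsetP=> e /FE.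
  rewrite !inE => /andP[eG ->] /=; exact: (forall_inP (edgesP G)).
apply: le_trans (gnp_prob_union_bound Q _ _ p01 dense) _.
rewrite (eq_bigr (fun=> p ^+ j.*2)) => [|[S F] /= /and3P[_ /fintype.subsetP FS /eqP <-]].
  rewrite -(pair_big_dep (fun S : {set 'I_n} => #|S| == j.+2)
    (fun S (F : {set {set 'I_n}}) => (F \subset pairs S) && (#|F| == j.*2))
    (fun _ _ => p ^+ j.*2)) /=.
  rewrite (eq_bigr (fun=> p ^+ j.*2 *+ 'C('C(j.+2, 2), j.*2))) => [|S /eqP cS].
    rewrite (eq_bigl (mem [set S : {set 'I_n} | #|S| == j.+2]%SET)) => [|S].
      by rewrite sumr_const card_draws card_ord -mulrnA mulnC -[leLHS]mulr_natl.
    by rewrite !inE.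
  rewrite (eq_bigl (mem [set F : {set {set 'I_n}} |
    F \subset pairs S & #|F| == j.*2]%SET)) => [|F]; last by rewrite !inE.
  by rewrite sumr_const cards_draws /pairs cards_draws cS.
by rewrite gnp_prob_subset_edges // => e /FS; rewrite inE => /andP[_ /eqP].
Qed.

(** * Bounding the expected number of dense sets *)

Lemma bin_expn_le {R : realType} (n k : nat) :
  ('C(n, k) * k ^ k)%:R <= (expR 1 * n%:R : R) ^+ k.
Proof.
(* A single term of the exponential series at k gives k^k / k! <= e^k. *)
have kk : (k ^ k)%:R <= expR 1 ^+ k * (k`!)%:R :> R.
  case: k => [|k]; first by rewrite expr0 mul1r.
  rewrite -expRM_natr mul1r natrX -ler_pdivrMr ?ltr0n ?fact_gt0 //.
  by apply: le_trans (expR_ge1Dxn k (ler0n R k.+1)); rewrite lerDr.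
have ff : ('C(n, k) * k`!)%:R <= n%:R ^+ k :> R.
  rewrite -natrX ler_nat bin_ffact ffact_prod -[X in (_ <= _ ^ X)%N]card_ord.
  by rewrite -prod_nat_const; apply: leq_prod => i _; exact: leq_subr.
rewrite natrM exprMn; apply: le_trans (ler_wpM2l _ kk) _ => //.
by rewrite mulrCA ler_wpM2l ?exprn_ge0 ?expR_ge0 // -natrM.
Qed.

Lemma expected_dense_le {R : realType} {n j : nat} {p : R} :
  0 <= p -> (0 < j)%N ->
  ('C(n, j.+2) * 'C('C(j.+2, 2), j.*2))%:R * p ^+ j.*2 <=
  (expR 1 * n%:R) ^+ 2 * (expR 1 ^+ 3 * j.+2%:R * (n%:R * p ^+ 2)) ^+ j.
Proof.
move=> p0 j0; set E : R := expR 1; have E0 : 0 <= E by exact: expR_ge0.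
have k1 : 1 <= j.+2%:R :> R by rewrite ler1n.
have C1 : 'C(n, j.+2)%:R * j.+2%:R ^+ j <= (E * n%:R) ^+ j.+2 :> R.
  apply: le_trans (bin_expn_le n j.+2); rewrite natrM natrX ler_wpM2l //.
  by rewrite ler_weXn2l //; lia.
(* With k = j + 2, the binomial bound is (e C(k, 2) / 2j)^(2j), and C(k, 2) <= 2jk because j >=
   1. *)
have C2 : 'C('C(j.+2, 2), j.*2)%:R <= (E * j.+2%:R) ^+ j.*2.
  have d0 : 0 < (j.*2%:R : R) by rewrite ltr0n double_gt0.
  rewrite -(ler_pM2r (exprn_gt0 j.*2 d0)) -exprMn -natrX -natrM.
  apply: le_trans (bin_expn_le _ _) _.
  rewrite lerXn2r ?nnegrE ?mulr_ge0 // -mulrA ler_wpM2l // -natrM ler_nat.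
  by rewrite bin2 -divn2; nia.
rewrite natrM.
apply: le_trans (_ : 'C(n, j.+2)%:R * (E * j.+2%:R) ^+ j.*2 * p ^+ j.*2 <= _).
  by rewrite ler_wpM2r ?exprn_ge0 // ler_wpM2l.
rewrite [leLHS](_ : _ = 'C(n, j.+2)%:R * j.+2%:R ^+ j *
    (E ^+ 2 * j.+2%:R * p ^+ 2) ^+ j); last first.
  rewrite -mul2n !exprM -[LHS]mulrA -[RHS]mulrA -!exprMn.
  by congr (_ * _ ^+ _); ring.
rewrite [leRHS](_ : _ = (E * n%:R) ^+ j.+2 * (E ^+ 2 * j.+2%:R * p ^+ 2) ^+ j).
  by rewrite ler_wpM2r ?exprn_ge0 ?mulr_ge0 ?exprn_ge0.
by rewrite -[in RHS]addn2 exprD [in RHS]mulrAC mulrC -exprMn; congr (_ ^+ _ * _); ring.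
Qed.

(** Here j is the integer part of ln n, so n^3 <= e^(3j + 3) costs only a factor e^3 per power of
    the base; that base is at most 2e^3 / j, and the product 2e^6 / j is at most 1. *)
Lemma gnp_prob_CFS_decay {R : realType} {n j : nat} {p : R} :
  0 <= p <= 1 -> (j.+2 <= n)%N -> j%:R <= ln (n%:R : R) < j.+1%:R ->
  2 * expR 1 ^+ 6 <= j%:R :> R -> p <= 1 / (Num.sqrt n%:R * ln n%:R) ->
  n%:R * gnp_prob p (@CFS 'I_n) <= expR 1 ^+ 5.
Proof.
move=> p01 jn /andP[jL Lj] Ej pL; have /andP[p0 p1] := p01.
set E : R := expR 1 in Ej *.
have E1 : 1 <= E by rewrite /E -expR0 ler_expR.
have E0 : 0 < E by exact: expR_gt0.
have j2 : (2 <= j)%N.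
  by rewrite -(ler_nat R); apply: le_trans Ej; rewrite ler_peMr // exprn_ege1.
have jR : 0 < j%:R :> R by rewrite ltr0n; lia.
have n0 : 0 < n%:R :> R by rewrite ltr0n; lia.
have nE : n%:R <= E ^+ j.+1.
  by rewrite -expRM_natr mul1r -[leLHS]lnK ?posrE // ler_expR ltW.
(* Replacing ln n by the smaller j weakens the bound on p to 1 / (sqrt n j). *)
have np : n%:R * p ^+ 2 <= (j%:R ^+ 2)^-1.
  have sL : 0 < Num.sqrt n%:R * j%:R :> R by rewrite mulr_gt0 ?sqrtr_gt0.
  have pj : p <= (Num.sqrt n%:R * j%:R)^-1.
    apply: le_trans pL _; rewrite div1r lef_pV2 ?posrE //.
      by rewrite ler_wpM2l ?sqrtr_ge0.
    by rewrite mulr_gt0 ?sqrtr_gt0 //; apply: lt_le_trans jL.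
  apply: le_trans (ler_wpM2l (ltW n0) (_ : _ <= (Num.sqrt n%:R * j%:R)^-1 ^+ 2)) _.
    by rewrite lerXn2r ?nnegrE // invr_ge0 ltW.
  by rewrite exprVn exprMn sqr_sqrtr ?(ltW n0) // invfM mulrA divff ?mul1r // gt_eqF.
have [Ege0 nge0 jge0] : [/\ 0 <= E, 0 <= n%:R :> R & 0 <= j%:R :> R] by split; exact: ltW.
have base : E ^+ 3 * j.+2%:R * (n%:R * p ^+ 2) <= 2 * E ^+ 3 / j%:R.
  apply: le_trans (_ : E ^+ 3 * (2 * j%:R) / j%:R ^+ 2 <= _).
    apply: ler_pM => //; rewrite ?mulr_ge0 ?exprn_ge0 //.
    by rewrite ler_wpM2l ?exprn_ge0 // -natrM ler_nat mul2n -addnn -addn2 leq_add2l.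
  rewrite le_eqVlt; apply/orP; left; apply/eqP.
  by field; rewrite gt_eqF.
apply: le_trans (ler_wpM2l (ltW n0) (gnp_prob_CFS_le j p01 jn)) _.
apply: le_trans (ler_wpM2l (ltW n0) (expected_dense_le p0 _)) _; first exact: ltnW.
rewrite -/E; set B := _ * (_ * _) in base *.
have B0 : 0 <= B by rewrite /B ?mulr_ge0 ?exprn_ge0.
(* The factor n of the claim joins the n^2 of the first-moment bound. *)
rewrite [leLHS](_ : _ = E ^+ 2 * (n%:R ^+ 3 * B ^+ j)); last by ring.
rewrite [leRHS](_ : _ = E ^+ 2 * E ^+ 3); last by ring.
rewrite ler_wpM2l ?exprn_ge0 //.
apply: le_trans (_ : (E ^+ j.+1) ^+ 3 * (2 * E ^+ 3 / j%:R) ^+ j <= _).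
  apply: ler_pM; rewrite ?exprn_ge0 //.
    by rewrite lerXn2r ?nnegrE ?exprn_ge0.
  by rewrite lerXn2r ?nnegrE ?divr_ge0 ?mulr_ge0 ?exprn_ge0.
rewrite -exprM mulSn exprD mulnC [(E ^+ (3 * j))]exprM -mulrA -exprMn.
rewrite ler_piMr ?exprn_ge0 // exprn_ile1 //.
  by rewrite ?(mulr_ge0, divr_ge0, exprn_ge0).
rewrite mulrA ler_pdivrMr // mul1r; apply: le_trans Ej.
by rewrite mulrCA -exprD.
Qed.

(** * Thresholds and passage to the limit *)

Theorem theorem4p7 (R : realType) (p : nat -> R)
    (p01 : forall n : nat, 0 <= p n <= 1)
    (p_le : forall n : nat, (2 <= n)%N ->
       p n <= 1 / (Num.sqrt (n%:R : R) * ln (n%:R : R))) :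
  aas p (fun n (G : sgraph 'I_n) => ~~ CFS G).
Proof.
pose E : R := expR 1.
have E2 : 2 <= E by apply: le_trans (expR_ge1Dx 1).
have E0 : 0 < E by exact: expR_gt0.
(* [M] exceeds 2e^6, as the decay bound asks of j, and n >= [N] forces ln n >= [M]. *)
pose M := (Num.truncn (2 * E ^+ 6)).+1; pose N := (Num.truncn (E ^+ M)).+1.
have M4 : (4 <= M)%N.
  have E5 : 1 <= E ^+ 5 by apply: exprn_ege1; lra.
  by rewrite ltnS leqNgt truncn_lt_nat -?leNgt ?exprS; nra.
have decay n : (N <= n)%N -> n%:R * gnp_prob (p n) (@CFS 'I_n) <= E ^+ 5.
  move=> Nn; have n0 : 0 < n%:R :> R by rewrite ltr0n; lia.
  have EMn : E ^+ M <= n%:R.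
    by apply: le_trans (ltW (truncnS_gt _)) _; rewrite ler_nat.
  have ML : M%:R <= ln (n%:R : R).
    by rewrite -ler_expR lnK ?posrE // -[M%:R]mul1r expRM_natr.
  have L0 : 0 <= ln (n%:R : R) by apply: le_trans ML.
  pose j := Num.truncn (ln (n%:R : R)).
  have jL := truncn_itv L0; rewrite -/j in jL.
  have Mj : (M <= j)%N by rewrite leqNgt truncn_lt_nat // -leNgt.
  have jn : (j.+2 <= n)%N.
    (* For j >= 4, j + 2 <= 1 + j^2 / 2 <= e^j <= n. *)
    rewrite -(ler_nat R); apply: le_trans (_ : 1 + j%:R ^+ 2 / 2 <= _).
      rewrite -addn2 natrD; have : 4 <= j%:R :> R by rewrite ler_nat; lia.
      nra.
    apply: le_trans (expR_ge1Dxn 1 (ler0n R j)) _.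
    by rewrite -[leRHS]lnK ?posrE // ler_expR; case/andP: jL.
  apply: (@gnp_prob_CFS_decay _ _ j) => //.
  - by apply: le_trans (ltW (truncnS_gt _)) _; rewrite ler_nat.
  - by apply: p_le; exact: leq_trans jn.
(* Since [harmonic n] is 1 / (n + 1) and n + 1 <= 2n, the bound e^5 / n is absorbed by doubling the
   constant. *)
rewrite /aas; apply: (@squeeze_cvgr _ _ _ _
  (fun n => 1 - 2 * E ^+ 5 * harmonic n) (fun=> 1)).
- exists N => // n /= Nn; rewrite gnp_prob_predC.
  have P0 : 0 <= gnp_prob (p n) (@CFS 'I_n).
    by apply: sumr_ge0 => G _; exact: gnp_weight_ge0.
  rewrite gerBl P0 andbT lerB // /harmonic ler_pdivlMr ?ltr0n //.
  have := decay n Nn; rewrite -natr1; have : 1 <= n%:R :> R by rewrite ler1n; lia.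
  nra.
- have lim : ((1 - 2 * E ^+ 5 * harmonic n : R) @[n --> \oo] -->
      (1 - 2 * E ^+ 5 * 0 : R))%classic.
    by apply: cvgB; [exact: cvg_cst|apply: cvgMr; exact: cvg_harmonic].
  by rewrite mulr0 subr0 in lim.
- exact: cvg_cst.
Qed.
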